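(* Let $A\in\mathbb{R}^{n\times n}$ be nonsingular and double irregular sparse, with $s_1\ge 1$ relatively dense columns and $s_2\ge 1$ relatively dense rows, let $b\in\mathbb{R}^n$ with $b\neq 0$, and let $\varepsilon>0$. Let $U_1=(u_1,\ldots,u_{s_1})$, $V_1=(e_{j_1},\ldots,e_{j_{s_1}})\in\mathbb{R}^{n\times s_1}$, $U_2=(e_{i_1},\ldots,e_{i_{s_2}})$, $V_2=(v_1,\ldots,v_{s_2})\in\mathbb{R}^{n\times s_2}$, $\tilde A=A-U_1V_1^T$ and $\hat A=\tilde A-U_2V_2^T$ be the matrices obtained from $A$ by the sparsification construction described in the context, and assume $\tilde A$ and $\hat A$ are nonsingular. Let $\check z\in\mathbb{R}^n$, $\check p_j\in\mathbb{R}^n$ ($j=1,\ldots,s_1$) and $\check q_j\in\mathbb{R}^n$ ($j=1,\ldots,s_2$) be approximate solutions (i.e. arbitrary vectors) of the linear systems $\hat A z=b$, $\hat A p=u_j$ ($j=1,\ldots,s_1$) and $\hat A q=e_{i_j}$ ($j=1,\ldots,s_2$), respectively. Define $\check P=(\check p_1,\ldots,\check p_{s_1})$, $\check Q=(\check q_1,\ldots,\check q_{s_2})$, and the residuals $$r_{\check z}=b-\hat A\check z,\qquad r_{\check p_j}=u_j-\hat A\check p_j,\qquad r_{\check q_j}=e_{i_j}-\hat A\check q_j.$$ Assume that $I+V_2^T\check Q$ is nonsingular, and define $$c_1=\|(I+V_2^T\check Q)^{-1}V_2^T\check z\|,\qquad c_2=\|(I+V_2^T\check Q)^{-1}V_2^T\check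 P\|,$$ $$\check y=\check z-\check Q(I+V_2^T\check Q)^{-1}V_2^T\check z,\qquad \check W=\check P-\check Q(I+V_2^T\check Q)^{-1}V_2^T\check P,$$ which are taken as approximations of $y=\tilde A^{-1}b$ and $W=\tilde A^{-1}U_1$, respectively. Assume that $I+V_1^T\check W$ is nonsingular, and define $$c_0=\|(I+V_1^T\check W)^{-1}V_1^T\check y\|,\qquad \check x=\check y-\check W(I+V_1^T\check W)^{-1}V_1^T\check y,$$ where $\check x$ is taken as an approximate solution of $Ax=b$. Suppose $c_0\neq 0$ and $c_0c_2+c_1\neq 0$. If $$\frac{\|r_{\check z}\|}{\|b\|}\le\frac{\varepsilon}{4},$$ $$\frac{\|r_{\check p_j}\|}{\|u_j\|}\le\frac{\|b\|}{4\sqrt{s_1}\,c_0\,\|u_j\|}\,\varepsilon,\qquad j=1,2,\ldots,s_1,$$ and $$\frac{\|r_{\check q_j}\|}{\|e_{i_j}\|}\le\frac{\|b\|}{2\sqrt{s_2}\,(c_0c_2+c_1)}\,\varepsilon,\qquad j=1,2,\ldots,s_2,$$ then $$\frac{\|b-A\check x\|}{\|b\|}\le\varepsilon.$$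
   Context: All matrices and vectors are real; $\|\cdot\|$ is the Euclidean norm of a vector and the induced 2-norm (spectral norm) of a matrix; $I$ is an identity matrix of the appropriate order; $e_k$ is the $k$th column of the $n\times n$ identity matrix; $nnz(\cdot)$ is the number of nonzero entries. Dense columns and rows. Put $p=\lfloor nnz(A)/n\rfloor$. A column of $A$ is called relatively dense (irregular) if it has more than $10p$ nonzero entries. Once $\tilde A$ is constructed as below, put $\tilde p=\lfloor nnz(\tilde A)/n\rfloor$; a row is called relatively dense if it has more than $10\tilde p$ nonzero entries. $A$ is double irregular sparse if it has at least one relatively dense column and at least one relatively dense row. Sparsification construction. Let $j_1,\ldots,j_{s_1}$ be the (distinct) indices of the relatively dense columns of $A$. For each $k$, let $a_{j_k}$ be the $j_k$th column of $A$ and let $\tilde a_{j_k}$ be obtained from $a_{j_k}$ by retaining $p$ of its nonzero entries and setting all the others to zero. Set $u_k=a_{j_k}-\tilde a_{j_k}$ (so $u_k\neq0$), $U_1=(u_1,\ldots,u_{s_1})$, $V_1=(e_{j_1},\ldots,e_{j_{s_1}})$, and $\tilde A=A-U_1V_1^T$; that is, $\tilde A$ is $A$ with each dense column $a_{j_k}$ replaced by $\tilde a_{j_k}$. Next let $i_1,\ldots,i_{s_2}$ be the (distinct) indices of the relatively dense rows of $\tilde A$. For each $k$, let $\tilde a_{i_k}^T$ be the $i_k$th row of $\tilde A$ and let $\hat a_{i_k}^T$ be obtained from it by retaining $\tilde p$ of its nonzero entries and setting all the others to zero. Set $v_k=\tilde a_{i_k}-\hat a_{i_k}$, $V_2=(v_1,\ldots,v_{s_2})$,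 $U_2=(e_{i_1},\ldots,e_{i_{s_2}})$, and $\hat A=\tilde A-U_2V_2^T$; that is, $\hat A$ is $\tilde A$ with each dense row $\tilde a_{i_k}^T$ replaced by $\hat a_{i_k}^T$. Thus $A=\hat A+U_1V_1^T+U_2V_2^T$. *)

(* Defs.v *)
From HB Require Import structures.
From mathcomp Require Import all_boot all_order all_algebra.
From mathcomp Require Import classical_sets reals.

Set Implicit Arguments.
Unset Strict Implicit.
Unset Printing Implicit Defensive.

Import Order.TTheory GRing.Theory Num.Theory.
Local Open Scope ring_scope.

(* The norm `|_| that MathComp-Analysis puts on matrices is the entrywise
   maximum norm, hence the explicit Euclidean and spectral norms below. *)
Definition enorm (R : realType) n (x : 'cV[R]_n) : R :=
  Num.sqrt (\sum_(k < n) x k 0 ^+ 2).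

(* Induced 2-norm.  For n = 0 the set is empty and [sup] returns 0. *)
Definition spectral_norm (R : realType) m n (M : 'M[R]_(m, n)) : R :=
  sup [set enorm (M *m x) | x in [set x : 'cV[R]_n | enorm x = 1]]%classic.

Definition stdvec (R : realType) n (k : 'I_n) : 'cV[R]_n := delta_mx k 0.
Arguments stdvec R {n} k.

Definition mx_of_cols (R : realType) n s (f : 'I_s -> 'cV[R]_n) : 'M[R]_(n, s) :=
  \matrix_(r, k) f k r 0.

Definition nnz (R : realType) m n (M : 'M[R]_(m, n)) : nat :=
  #|[pred rc : 'I_m * 'I_n | M rc.1 rc.2 != 0]|.

Definition avg_nnz (R : realType) n (M : 'M[R]_n) : nat := (nnz M %/ n)%N.

Definition dense_col (R : realType) n (M : 'M[R]_n) (c : 'I_n) : bool :=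
  (10 * avg_nnz M < nnz (col c M))%N.

Definition dense_row (R : realType) n (M : 'M[R]_n) (r : 'I_n) : bool :=
  (10 * avg_nnz M < nnz (row r M))%N.

(* Dense columns are those of [A]; dense rows are those of the matrix [At]
   obtained from [A] by sparsifying its dense columns. *)
Definition double_irregular (R : realType) n (A At : 'M[R]_n) : Prop :=
  (exists c, dense_col A c) /\ (exists r, dense_row At r).

(* [f] lists, in some order and without repetition, the indices satisfying [P]. *)
Definition enumerates s n (f : 'I_s -> 'I_n) (P : pred 'I_n) : Prop :=
  injective f /\ (forall c, P c <-> exists k, f k = c).

(* [w] keeps exactly [p] nonzero entries of [v], the others being set to 0;
   which entries are kept is left free. *)
Definition retains (R : realType) n (p : nat) (v w : 'cV[R]_n) : Prop :=
  exists S : {set 'I_n},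
    [/\ forall r, r \in S -> v r 0 != 0,
        #|S| = p
      & w = \col_r (if r \in S then v r 0 else 0)].

(* Main.v *)
(** With [t = M1^-1 V1^T y] and [g = M2^-1 V2^T z] one has [V1^T x = t] and
    [V2^T y = g], so that the rank corrections cancel and the residual of [x] is
    exactly [r_z - Rp t + Rq (G t - g)], where [G = M2^-1 V2^T P] and [Rp], [Rq]
    have the residuals [r_p], [r_q] as columns.  The three summands are bounded
    by [eps/4], [eps/4] and [eps/2] times the norm of [b]. *)
Require Import Defs.
From HB Require Import structures.
From mathcomp Require Import all_boot all_order all_algebra.
From mathcomp Require Import reals.
From mathcomp Require Import ring lra.
Set Implicit Arguments.
Unset Strict Implicit.
Unset Printing Implicit Defensive.

Import Order.TTheory GRing.Theory Num.Theory.
Local Open Scope ring_scope.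

(** No division is used: [Sb] times the gap between the two sides is the sum of the squares of
    [Sb * a k - Sab * b k]. If [Sb] is positive it can be cancelled; if it is 0, every [b k]
    vanishes and so does [Sab]. *)
Lemma cauchy_schwarz_sum (R : realDomainType) (I : finType) (a b : I -> R) :
  (\sum_k a k * b k) ^+ 2 <= (\sum_k a k ^+ 2) * (\sum_k b k ^+ 2).
Proof.
set Sab := \sum_k _ * _; set Sa := \sum_k a k ^+ 2; set Sb := \sum_k b k ^+ 2.
have Sb_ge0 : 0 <= Sb by apply: sumr_ge0 => k _; exact: sqr_ge0.
have key : 0 <= Sb * (Sa * Sb - Sab ^+ 2).
  have -> : Sb * (Sa * Sb - Sab ^+ 2) = \sum_k (Sb * a k - Sab * b k) ^+ 2.
    transitivity (Sb ^+ 2 * Sa - (2 * Sb * Sab) * Sab + Sab ^+ 2 * Sb).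
      by ring.
    rewrite [in LHS](mulr_sumr _ _ _ (Sb ^+ 2)) (mulr_sumr _ _ _ (2 * Sb * Sab)).
    rewrite (mulr_sumr _ _ _ (Sab ^+ 2)) -sumrB -big_split /=.
    by apply: eq_bigr => k _; ring.
  by apply: sumr_ge0 => k _; exact: sqr_ge0.
have [Sb0|Sb_neq0] := eqVneq Sb 0; last first.
  by rewrite -subr_ge0 -(pmulr_rge0 _ (_ : 0 < Sb)) // lt0r Sb_neq0.
have b0 k : b k = 0.
  have /psumr_eq0P : forall k, true -> 0 <= b k ^+ 2 by move=> ? _; exact: sqr_ge0.
  by move=> /(_ Sb0 k isT)/eqP; rewrite sqrf_eq0 => /eqP.
by rewrite Sb0 mulr0 /Sab big1 ?expr0n // => k _; rewrite b0 mulr0.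
Qed.

Section EuclideanNorm.
Context {R : realType}.

Lemma enorm_ge0 n (x : 'cV[R]_n) : 0 <= enorm x.
Proof. exact: sqrtr_ge0. Qed.

Lemma sqr_enorm n (x : 'cV[R]_n) : enorm x ^+ 2 = \sum_k x k 0 ^+ 2.
Proof. by rewrite sqr_sqrtr //; apply: sumr_ge0 => k _; exact: sqr_ge0. Qed.

Lemma enorm_eq0 n (x : 'cV[R]_n) : (enorm x == 0) = (x == 0).
Proof.
apply/eqP/eqP => [x0|->]; last first.
  by apply/eqP; rewrite -sqrf_eq0 sqr_enorm big1 // => k _; rewrite mxE expr0n.
have /psumr_eq0P : forall k, true -> 0 <= x k 0 ^+ 2 by move=> ? _; exact: sqr_ge0.
rewrite -sqr_enorm x0 expr0n /= => /(_ erefl) h.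
apply/matrixP => k l; rewrite ord1 mxE.
by apply/eqP; rewrite -sqrf_eq0 h.
Qed.

Lemma enorm0 n : enorm (0 : 'cV[R]_n) = 0.
Proof. by apply/eqP; rewrite enorm_eq0. Qed.

Lemma enorm_gt0 n (x : 'cV[R]_n) : (0 < enorm x) = (x != 0).
Proof. by rewrite lt0r enorm_ge0 andbT enorm_eq0. Qed.

Lemma enormZ n (a : R) (x : 'cV[R]_n) : enorm (a *: x) = `|a| * enorm x.
Proof.
apply: (pexpIrn (isT : (0 < 2)%N)); rewrite ?nnegrE ?mulr_ge0 ?enorm_ge0 //.
rewrite exprMn !sqr_enorm real_normK ?num_real // mulr_sumr.
by apply: eq_bigr => k _; rewrite mxE exprMn.
Qed.

Lemma enormN n (x : 'cV[R]_n) : enorm (- x) = enorm x.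
Proof. by rewrite -scaleN1r enormZ normrN1 mul1r. Qed.

Lemma ler_enormD n (x y : 'cV[R]_n) : enorm (x + y) <= enorm x + enorm y.
Proof.
rewrite -ler_sqr ?nnegrE ?addr_ge0 ?enorm_ge0 // sqrrD !sqr_enorm.
have -> : \sum_k (x + y) k 0 ^+ 2
    = \sum_k x k 0 ^+ 2 + (\sum_k x k 0 * y k 0) *+ 2 + \sum_k y k 0 ^+ 2.
  by rewrite -sumrMnl -!big_split; apply: eq_bigr => k _; rewrite mxE sqrrD.
rewrite lerD2r lerD2l lerMn2r /=; apply: le_trans (ler_norm _) _.
rewrite -ler_sqr ?nnegrE ?mulr_ge0 ?enorm_ge0 // real_normK ?num_real //.
by rewrite exprMn !sqr_enorm cauchy_schwarz_sum.
Qed.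

Lemma ler_enorm_sum n (I : finType) (f : I -> 'cV[R]_n) :
  enorm (\sum_k f k) <= \sum_k enorm (f k).
Proof.
elim/big_ind2: _ => //= [|u a w c ua wc].
  by rewrite enorm0.
exact: le_trans (ler_enormD _ _) (lerD ua wc).
Qed.

(** Cauchy-Schwarz against the constant vector 1. The factors [Num.sqrt s1%:R] and [Num.sqrt s2%:R]
    in the tolerances come from here. *)
Lemma sum_norm_le_enorm n (x : 'cV[R]_n) :
  \sum_k `|x k 0| <= Num.sqrt n%:R * enorm x.
Proof.
rewrite -ler_sqr ?nnegrE ?mulr_ge0 ?enorm_ge0 ?sqrtr_ge0 ?sumr_ge0 //.
rewrite exprMn sqr_sqrtr ?ler0n // sqr_enorm.
have := cauchy_schwarz_sum (fun=> 1) (fun k => `|x k 0|).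
under eq_bigr do rewrite mul1r; under [X in _ <= X * _]eq_bigr do rewrite expr1n.
under [X in _ <= _ * X]eq_bigr do rewrite real_normK ?num_real //.
by rewrite sumr_const card_ord.
Qed.

(** [M *m x] is the combination of the columns of [M] with coefficients [x k 0]. This turns bounds
    on single residuals into a bound on the matrix that has them as columns. *)
Lemma enorm_mulmx_le m n (M : 'M[R]_(m, n)) (K : R) (x : 'cV[R]_n) :
  (forall k, enorm (col k M) <= K) ->
  enorm (M *m x) <= K * (\sum_k `|x k 0|).
Proof.
move=> MK; have -> : M *m x = \sum_k x k 0 *: col k M.
  apply/matrixP => r l; rewrite ord1 !mxE summxE.
  by apply: eq_bigr => k _; rewrite !mxE mulrC.
apply: le_trans (ler_enorm_sum _) _; rewrite mulr_sumr.
by apply: ler_sum => k _; rewrite enormZ mulrC ler_wpM2r.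
Qed.

Lemma enorm_stdvec n (k : 'I_n) : enorm (stdvec R k) = 1.
Proof.
rewrite /enorm (bigD1 k) //= big1 => [|l lk]; rewrite mxE !eqxx.
  by rewrite addr0 expr1n sqrtr1.
by rewrite (negPf lk) expr0n.
Qed.

(** After normalising [x], the quotient is a member of the set whose supremum is [spectral_norm M].
    The supremum dominates its members only once the set is shown to be bounded above. *)
Lemma enorm_mulmx_le_spectral m n (M : 'M[R]_(m, n)) (x : 'cV[R]_n) :
  enorm (M *m x) <= spectral_norm M * enorm x.
Proof.
have [->|x_neq0] := eqVneq x 0.
  by rewrite mulmx0 !enorm0 mulr0.
have nx_gt0 : 0 < enorm x by rewrite enorm_gt0.
rewrite -ler_pdivrMr //.
have -> : enorm (M *m x) / enorm x = enorm (M *m ((enorm x)^-1 *: x)).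
  by rewrite -scalemxAr enormZ ger0_norm ?invr_ge0 ?enorm_ge0 // mulrC.
apply: ub_le_sup; last first.
  exists ((enorm x)^-1 *: x) => //=.
  by rewrite enormZ ger0_norm ?invr_ge0 ?enorm_ge0 // mulVf ?gt_eqF.
(* Any upper bound on the image of the unit sphere will do; the sum of all column norms times the
   square root of [n] is a crude one. *)
set K := \sum_k enorm (col k M).
exists (K * Num.sqrt n%:R) => _ [w /= w1 <-].
apply: le_trans (enorm_mulmx_le (K := K) _ _) _ => [k|].
  by rewrite /K (bigD1 k) //= lerDl sumr_ge0 // => l _; exact: enorm_ge0.
apply: ler_wpM2l; first by apply: sumr_ge0 => l _; exact: enorm_ge0.
by have := sum_norm_le_enorm w; rewrite w1 mulr1.
Qed.

End EuclideanNorm.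

Lemma col_mx_of_cols (R : realType) n s (f : 'I_s -> 'cV[R]_n) k :
  col k (mx_of_cols f) = f k.
Proof. by apply/matrixP => r l; rewrite !mxE ord1. Qed.

Lemma mulmx_mx_of_cols (R : realType) m n s (M : 'M[R]_(m, n))
    (f : 'I_s -> 'cV[R]_n) :
  M *m mx_of_cols f = mx_of_cols (fun k => M *m f k).
Proof.
by apply/matrixP => r l; rewrite !mxE; apply: eq_bigr => ? _; rewrite !mxE.
Qed.

Lemma mx_of_colsB (R : realType) n s (f g : 'I_s -> 'cV[R]_n) :
  mx_of_cols (fun k => f k - g k) = mx_of_cols f - mx_of_cols g.
Proof. by apply/matrixP => r l; rewrite !mxE. Qed.

(** A vector unchanged by the truncation has the retained set [S] as its support. [nnz] counts index
    pairs, so [S] is embedded by [r] to [(r, 0)]. *)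
Lemma nnz_retains (R : realType) n p (w : 'cV[R]_n) :
  retains p w w -> nnz w = p.
Proof.
case=> S [S_neq0 <- wE].
rewrite -(card_imset S (_ : injective (fun r => (r, 0 : 'I_1)))).
  apply: eq_card => -[r l]; rewrite !inE /= (ord1 l).
  apply/idP/imsetP => [|[r' r'S [->]]]; last exact: S_neq0.
  rewrite {1}wE mxE; case: ifP => [rS _|]; last by rewrite eqxx.
  by exists r.
by move=> r r' [].
Qed.

(* [V^T] maps the corrected [Z] to [G], so [U V^T] contributes exactly [U G] and
   only the residual of [Q] is amplified. *)
Lemma woodbury_residual (R : comUnitRingType) n s m
    (B : 'M[R]_n) (U V Q : 'M[R]_(n, s)) (D Z : 'M[R]_(n, m)) :
  let M := 1%:M + V^T *m Q in
  let G := invmx M *m V^T *m Z in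
  M \in unitmx ->
  D - (B + U *m V^T) *m (Z - Q *m invmx M *m V^T *m Z)
    = (D - B *m Z) - (U - B *m Q) *m G.
Proof.
move=> M G Mu.
(* This is [M *m G = V^T *m Z] with [M] expanded. *)
have VG : V^T *m Z = G + V^T *m Q *m G.
  by rewrite -{1}[G]mul1mx -mulmxDl -/M /G -!mulmxA mulKVmx.
have -> : Q *m invmx M *m V^T *m Z = Q *m G by rewrite /G !mulmxA.
have cancelG : V^T *m (Z - Q *m G) = G by rewrite mulmxBr VG !mulmxA addrK.
rewrite mulmxDl -(mulmxA U) cancelG mulmxBr mulmxBl !mulmxA.
by rewrite !opprD !opprK !addrA addrAC.
Qed.

Theorem theorem4p3 (R : realType) (n s1 s2 : nat)
    (A : 'M[R]_n) (b : 'cV[R]_n) (eps : R)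
    (j : 'I_s1 -> 'I_n) (atil : 'I_s1 -> 'cV[R]_n)
    (i : 'I_s2 -> 'I_n) (ahat : 'I_s2 -> 'cV[R]_n)
    (z : 'cV[R]_n) (p : 'I_s1 -> 'cV[R]_n) (q : 'I_s2 -> 'cV[R]_n) :
  A \in unitmx -> b != 0 -> 0 < eps ->
  (1 <= s1)%N -> (1 <= s2)%N ->
  enumerates j (dense_col A) ->
  (forall k, retains (avg_nnz A) (col (j k) A) (atil k)) ->
  let u := fun k => col (j k) A - atil k in
  let U1 := mx_of_cols u in
  let V1 := mx_of_cols (fun k => stdvec R (j k)) in
  let Atil := A - U1 *m V1^T in
  double_irregular A Atil ->
  enumerates i (dense_row Atil) ->
  (forall k, retains (avg_nnz Atil) (row (i k) Atil)^T (ahat k)) ->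
  let v := fun k => (row (i k) Atil)^T - ahat k in
  let V2 := mx_of_cols v in
  let U2 := mx_of_cols (fun k => stdvec R (i k)) in
  let Ahat := Atil - U2 *m V2^T in
  Atil \in unitmx -> Ahat \in unitmx ->
  let P := mx_of_cols p in
  let Q := mx_of_cols q in
  let r_z := b - Ahat *m z in
  let r_p := fun k => u k - Ahat *m p k in
  let r_q := fun k => stdvec R (i k) - Ahat *m q k in
  let M2 := 1%:M + V2^T *m Q in
  M2 \in unitmx ->
  let c1 := enorm (invmx M2 *m V2^T *m z) in
  let c2 := spectral_norm (invmx M2 *m V2^T *m P) in
  let y := z - Q *m invmx M2 *m V2^T *m z in
  let W := P - Q *m invmx M2 *m V2^T *m P in
  let M1 := 1%:M + V1^T *m W in
  M1 \in unitmx ->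
  let c0 := enorm (invmx M1 *m V1^T *m y) in
  let x := y - W *m invmx M1 *m V1^T *m y in
  c0 != 0 -> c0 * c2 + c1 != 0 ->
  enorm r_z / enorm b <= eps / 4 ->
  (forall k, enorm (r_p k) / enorm (u k)
             <= enorm b / (4 * Num.sqrt s1%:R * c0 * enorm (u k)) * eps) ->
  (forall k, enorm (r_q k) / enorm (stdvec R (i k))
             <= enorm b / (2 * Num.sqrt s2%:R * (c0 * c2 + c1)) * eps) ->
  enorm (b - A *m x) / enorm b <= eps.
Proof.
move=> _ b_neq0 eps_gt0 s1_gt0 s2_gt0 [_ jP] atilP u U1 V1 Atil _ _ _ v V2 U2.
move=> Ahat _ _ P Q r_z r_p r_q M2 M2u c1 c2 y W M1 M1u c0 x c0_neq0 c_neq0.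
move=> hz hp hq.
have nb_gt0 : 0 < enorm b by rewrite enorm_gt0.
have c0_gt0 : 0 < c0 by rewrite lt0r c0_neq0 enorm_ge0.
have sqrt_gt0 s : (0 < s)%N -> 0 < Num.sqrt s%:R :> R by rewrite sqrtr_gt0 ltr0n.
(* [u k] is nonzero because fewer entries are retained than the dense column
   has; otherwise [hp] would be vacuous, division by zero being zero. *)
have u_gt0 k : 0 < enorm (u k).
  rewrite enorm_gt0 subr_eq0; apply/eqP => colE.
  have := atilP k; rewrite -colE => /nnz_retains nnzE.
  have : dense_col A (j k) by apply/jP; exists k.
  (* [10 * p < p] fails for every natural [p], including 0. *)
  by rewrite /dense_col nnzE ltnNge leq_pmull.
set t := invmx M1 *m V1^T *m y; set g := invmx M2 *m V2^T *m z.
set G := invmx M2 *m V2^T *m P.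
have AE : A = Atil + U1 *m V1^T by rewrite subrK.
have AtilE : Atil = Ahat + U2 *m V2^T by rewrite subrK.
have RpE : mx_of_cols r_p = U1 - Ahat *m P.
  by rewrite mulmx_mx_of_cols -mx_of_colsB.
have RqE : mx_of_cols r_q = U2 - Ahat *m Q.
  by rewrite mulmx_mx_of_cols -mx_of_colsB.
have resE : b - A *m x
    = r_z - mx_of_cols r_p *m t + mx_of_cols r_q *m (G *m t - g).
  (* The outer correction leaves [(b - Atil *m y) - (U1 - Atil *m W) *m t]. The inner one is then
     applied to both residuals, with right-hand sides [b] and [U1]; each yields a multiple of
     [U2 - Ahat *m Q], by [g] and by [G]. *)
  rewrite AE (woodbury_residual Atil U1 b y M1u).
  rewrite {1 2}AtilE (woodbury_residual Ahat U2 b z M2u).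
  rewrite (woodbury_residual Ahat U2 U1 P M2u).
  rewrite -RpE -RqE -/t -/g -/G -/r_z mulmxBl mulmxBr !mulmxA.
  by rewrite opprB addrACA [RHS]addrACA; congr (_ + _); exact: addrC.
have Gtg_le : enorm (G *m t - g) <= c0 * c2 + c1.
  apply: le_trans (ler_enormD _ _) _.
  by rewrite enormN lerD2r mulrC enorm_mulmx_le_spectral.
(* Nonnegativity is read off from [Gtg_le], whose left side is a norm, so the sign of the supremum
   [c2] is never examined. *)
have c_gt0 : 0 < c0 * c2 + c1.
  by rewrite lt0r c_neq0 (le_trans (enorm_ge0 _) Gtg_le).
(* The factor [enorm (u k)] cancels, which makes the bound uniform in [k]. *)
have r_p_le k : enorm (r_p k) <= enorm b * eps / (4 * Num.sqrt s1%:R * c0).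
  have := hp k; rewrite ler_pdivrMr // => /le_trans; apply.
  rewrite le_eqVlt; apply/orP; left; apply/eqP; field.
  by rewrite !gt_eqF // sqrt_gt0.
have r_q_le k :
    enorm (r_q k) <= enorm b * eps / (2 * Num.sqrt s2%:R * (c0 * c2 + c1)).
  by have := hq k; rewrite enorm_stdvec divr1 mulrAC.
have Rp_le : enorm (mx_of_cols r_p *m t) <= enorm b * eps / 4.
  apply: le_trans (enorm_mulmx_le (M := mx_of_cols r_p) _ _) _ => [k|].
    by rewrite col_mx_of_cols; exact: r_p_le.
  (* The entries of [t] have absolute sum at most [Num.sqrt s1%:R * c0], exactly the factor in the
     denominator of [r_p_le]. *)
  have -> : enorm b * eps / 4
      = enorm b * eps / (4 * Num.sqrt s1%:R * c0) * (Num.sqrt s1%:R * c0).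
    by field; rewrite !gt_eqF // sqrt_gt0.
  apply: ler_wpM2l (sum_norm_le_enorm t).
  by rewrite divr_ge0 ?mulr_ge0 // ltW ?sqrt_gt0.
have Rq_le : enorm (mx_of_cols r_q *m (G *m t - g)) <= enorm b * eps / 2.
  apply: le_trans (enorm_mulmx_le (M := mx_of_cols r_q) _ _) _ => [k|].
    by rewrite col_mx_of_cols; exact: r_q_le.
  have -> : enorm b * eps / 2 = enorm b * eps
      / (2 * Num.sqrt s2%:R * (c0 * c2 + c1)) * (Num.sqrt s2%:R * (c0 * c2 + c1)).
    by field; rewrite !gt_eqF // sqrt_gt0.
  (* The absolute sum of the entries is bounded in two stages: by [Num.sqrt s2%:R] times the
     Euclidean norm, then by [Gtg_le]. *)
  apply: ler_wpM2l.
    by rewrite divr_ge0 ?mulr_ge0 // ltW ?sqrt_gt0.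
  apply: le_trans (sum_norm_le_enorm _) _.
  by rewrite ler_wpM2l // sqrtr_ge0.
have rz_le : enorm r_z <= enorm b * eps / 4.
  by move: hz; rewrite ler_pdivrMr // mulrC mulrA.
rewrite ler_pdivrMr // resE.
apply: le_trans (ler_enormD _ _) _.
apply: le_trans (lerD (ler_enormD _ _) Rq_le) _; rewrite enormN; lra.
Qed.
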